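(* Let $\mathcal{L}$ be the set consisting of the empty path, the paths $U^{\ell}C_{\ell}$ with $\ell\ge 1$, and the paths $P\in\mathcal{E}$ of the form $$P=U^{\ell_1}(DU)^{k_1}U^{\ell_2}(DU)^{k_2}\cdots U^{\ell_r}(DU)^{k_r}U^{\ell_{r+1}}C_s$$ with $r\ge 1$, $\ell_i,k_i\ge 1$ for $1\le i\le r$, $\ell_{r+1}\ge 0$, and $s\ge 1$ such that the path ends on the $x$-axis (with the convention $C_1=D$). The ordinary generating function $L(x)=\sum_{P\in\mathcal{L}}x^{|P|}$ of $\mathcal{L}$ with respect to the length is $$L(x)=\frac{1-x}{1-x-x^2},$$ and its series expansion is $$1+x^2+x^3+2x^4+3x^5+5x^6+8x^7+13x^8+21x^9+34x^{10}+55x^{11}+O(x^{12}).$$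
   Context: A Dyck path with catastrophes is a finite lattice path in the first quadrant ($y\ge 0$) starting at the origin, ending on the $x$-axis, with steps $U=(1,1)$, $D=(1,-1)$ and catastrophe steps $C_k=(1,-k)$, $k\ge 2$, where a catastrophe step must end on the $x$-axis (so $C_k$ can only be used from height $k$). By convention $C_1=D$. $\mathcal{E}$ is the set of all Dyck paths with catastrophes (including the empty path). The length $|P|$ is the number of steps of $P$; paths are written as words in the steps. Generating functions are formal power series in $x$. *)

(* Defs.v *)
From HB Require Import structures.
From mathcomp Require Import all_boot all_order all_algebra.
From mathcomp Require Import finmap.
From mathcomp Require Import boolp classical_sets functions cardinality.

Set Implicit Arguments.
Unset Strict Implicit.
Unset Printing Implicit Defensive.

Import Order.TTheory GRing.Theory Num.Theory.

Local Open Scope classical_set_scope.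
Local Open Scope ring_scope.

(* A formal power series is its sequence of coefficients. The product below is
   the Cauchy product, not the pointwise product of functions. *)
Definition fps (R : Type) := nat -> R.

Definition fps_of_poly (R : nzRingType) (p : {poly R}) : fps R := fun n => p`_n.

Definition fps_mul (R : nzRingType) (f g : fps R) : fps R :=
  fun n => \sum_(i < n.+1) f i * g (n - i)%N.

(* The first n coefficients of 1/g, from the recursion
   h_0 = 1/g_0,  h_m = - (1/g_0) * (g_1 h_(m-1) + ... + g_m h_0). *)
Fixpoint fps_inv_coefs (R : unitRingType) (g : fps R) (n : nat) : seq R :=
  if n is m.+1 then
    let s := fps_inv_coefs g m in
    rcons s (if m == 0%N then (g 0%N)^-1
             else - ((g 0%N)^-1 * \sum_(i < m) g i.+1 * s`_(m - i.+1)))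
  else [::].

(* Only meaningful when the constant coefficient of g is a unit. *)
Definition fps_inv (R : unitRingType) (g : fps R) : fps R :=
  fun n => (fps_inv_coefs g n.+1)`_n.

Definition fps_div (R : unitRingType) (f g : fps R) : fps R :=
  fps_mul f (fps_inv g).

(* f = g + O(x^N) *)
Definition fps_eqO (R : Type) (N : nat) (f g : fps R) : Prop :=
  forall n, (n < N)%N -> f n = g n.

Lemma size_fps_inv_coefs (R : unitRingType) (g : fps R) n :
  size (fps_inv_coefs g n) = n.
Proof. by elim: n => //= n IHn; rewrite size_rcons IHn. Qed.

Lemma nth_fps_inv_coefs (R : unitRingType) (g : fps R) n i :
  (i < n)%N -> (fps_inv_coefs g n)`_i = fps_inv g i.
Proof.
elim: n => // n IHn; rewrite ltnS leq_eqVlt => /predU1P[-> //|lt_in].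
by rewrite -IHn //= nth_rcons size_fps_inv_coefs lt_in.
Qed.

Lemma fps_mulV (R : unitRingType) (g : fps R) :
  g 0%N \is a GRing.unit -> fps_mul g (fps_inv g) = fps_of_poly 1.
Proof.
move=> g0U; apply/funext => n; rewrite /fps_mul /fps_of_poly coef1.
rewrite big_ord_recl /= subn0 [fps_inv g n]/fps_inv /= nth_rcons.
rewrite size_fps_inv_coefs ltnn eqxx; case: n => [|n] /=.
  by rewrite big_ord0 addr0 mulrV.
rewrite mulrN mulrA mulrV // mul1r addrC; apply/eqP; rewrite subr_eq0; apply/eqP.
apply: eq_bigr => i _.
by rewrite -(@nth_fps_inv_coefs _ _ n.+1) //= ltnS subSS leq_subr.
Qed.

(* Cat k is the catastrophe C_k for k >= 2; the bound on k is imposed by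
   catpath. *)
Inductive step := Up | Down | Cat of nat.

Definition nat_of_step (s : step) : nat :=
  match s with Up => 0 | Down => 1 | Cat k => k.+2 end.
Definition step_of_nat (n : nat) : step :=
  match n with 0 => Up | 1 => Down | k.+2 => Cat k end.
Lemma nat_of_stepK : cancel nat_of_step step_of_nat.
Proof. by case. Qed.
HB.instance Definition _ := Countable.copy step (can_type nat_of_stepK).

(* C_k with the convention C_1 = D *)
Definition Cstep (k : nat) : step := if k == 1%N then Down else Cat k.

(* P is a legal sequence of steps from height h that ends at height 0. *)
Fixpoint catpath (h : nat) (P : seq step) : bool :=
  match P with
  | [::] => h == 0%N
  | Up :: P' => catpath h.+1 P'
  | Down :: P' => (0 < h)%N && catpath h.-1 P'
  | Cat k :: P' => [&& (2 <= k)%N, k == h & catpath 0%N P']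
  end.

Definition EE : set (seq step) := [set P | catpath 0%N P].

Definition LL : set (seq step) :=
  [set P |
    [\/ P = [::],
        exists2 l : nat, (1 <= l)%N & P = rcons (nseq l Up) (Cstep l)
      | EE P /\
        exists (r : nat) (l k : nat -> nat) (s : nat),
          [/\ (1 <= r)%N,
              forall i, (1 <= i <= r)%N -> (1 <= l i)%N /\ (1 <= k i)%N,
              (1 <= s)%N
            & P = \big[cat/[::]]_(1 <= i < r.+1)
                    (nseq (l i) Up ++ flatten (nseq (k i) [:: Down; Up]))
                  ++ nseq (l r.+1) Up ++ [:: Cstep s]]]].

Definition of_length (A : set (seq step)) (n : nat) : set (seq step) :=
  A `&` [set P | size P = n].

(* fset_set is the empty set on infinite sets; finite_of_length_EE shows that
   this does not occur for sets of Dyck paths with catastrophes. *)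
Definition ogf (A : set (seq step)) : fps int :=
  fun n => (#|` fset_set (of_length A n)|)%:Z.

Lemma catpath_bounded h P :
  catpath h P -> all (fun s => (nat_of_step s < (h + size P).+3)%N) P.
Proof.
have mono m n Q : (m <= n)%N -> all (fun s => (nat_of_step s < m)%N) Q ->
    all (fun s => (nat_of_step s < n)%N) Q.
  by move=> le_mn; apply: sub_all => s /leq_trans; apply.
elim: P h => [|[||k] P IHP] h //=.
- by move=> /IHP; rewrite addSnnS.
- by case: h => //= h /IHP; apply: mono; rewrite !ltnS leq_add.
- move=> /and3P[_ /eqP-> /IHP aP]; rewrite !ltnS leq_addr /=.
  by apply: mono aP; rewrite !ltnS add0n addnS ltnW // ltnS leq_addl.
Qed.

Lemma finite_of_length_EE n : finite_set (of_length EE n).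
Proof.
pose f (t : n.-tuple 'I_(n.+3)) := [seq step_of_nat (nat_of_ord i) | i <- t].
apply: (@sub_finite_set _ _ (f @` setT)); last exact/finite_image/finite_finset.
move=> P [] /catpath_bounded + /= szP; rewrite add0n szP => /allP bP.
have szt : size [seq inord (nat_of_step s) : 'I_(n.+3) | s <- P] == n.
  by rewrite size_map szP.
exists (Tuple szt) => //; rewrite /f /= -map_comp -[RHS]map_id.
by apply/eq_in_map => s /bP lt_s /=; rewrite inordK // nat_of_stepK.
Qed.

Lemma catpath_nseq_Up h l P :
  catpath h (nseq l Up ++ P) = catpath (h + l)%N P.
Proof. by elim: l h => [|l IHl] h /=; rewrite ?addn0 // IHl addSnnS. Qed.

Lemma LL_sub_EE : LL `<=` EE.
Proof.
move=> P [->//|[l l_gt0 ->]|[]//].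
rewrite /EE /= -cats1 catpath_nseq_Up add0n /Cstep.
case: eqP => [->//|/eqP l_neq1] /=.
by rewrite eqxx; case: l l_gt0 l_neq1 => [|[]].
Qed.

(* Main.v *)
Require Import Defs.
From mathcomp Require Import all_boot all_order all_algebra.
From mathcomp Require Import finmap.
From mathcomp Require Import boolp classical_sets functions cardinality.

Import GRing.Theory.

Local Open Scope ring_scope.

(** A nonempty element of LL is [U w C_s], where [w] is an arbitrary word in the
tiles [U] and [DU]: the exponents [l_i], [k_i] are the lengths of the runs of
equal tiles in [U w].  Each tile [U] raises the height by one and a tile [DU]
preserves it, so that [s] is determined by [w].  Hence the paths of length
[n + 2] correspond to the tilings of a strip of length [n] by tiles of lengths 1
and 2, and their numbers satisfy the Fibonacci recursion, as do the coefficients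
of [1 / (1 - x - x^2)]. *)

(** * Words in the tiles U and DU, and their legality *)

Definition tile (b : bool) : seq step := if b then [:: Up] else [:: Down; Up].

Definition tile_word (t : seq bool) : seq step := flatten (map tile t).

Definition LL_path (t : seq bool) : seq step :=
  Up :: tile_word t ++ [:: Cstep (count id t).+1].

Fixpoint tilings (n : nat) : seq (seq bool) :=
  match n with
  | 0 => [:: [::]]
  | 1 => [:: [:: true]]
  | (m.+1 as m').+1 => map (cons true) (tilings m') ++ map (cons false) (tilings m)
  end.

Lemma tile_word_cat t1 t2 : tile_word (t1 ++ t2) = tile_word t1 ++ tile_word t2.
Proof. by rewrite /tile_word map_cat flatten_cat. Qed.

Lemma tile_word_nseq_true l : tile_word (nseq l true) = nseq l Up.
Proof. by elim: l => //= l <-. Qed.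

Lemma tile_word_nseq_false k :
  tile_word (nseq k false) = flatten (nseq k [:: Down; Up]).
Proof. by rewrite /tile_word map_nseq. Qed.

(** A tile DU begins with a descent, so the starting height has to be positive; it stays positive
    from tile to tile. *)
Lemma catpath_tile_word h t P :
  catpath h.+1 (tile_word t ++ P) = catpath (h.+1 + count id t) P.
Proof.
by elim: t h => [|[] t IHt] h /=; rewrite ?addn0 // -/(tile_word t) IHt // addSnnS.
Qed.

(** For [s = 0] this would fail at [h = 0], since [Cat 0] is never legal. *)
Lemma catpath_Cstep h s : (0 < s)%N -> catpath h [:: Cstep s] = (s == h).
Proof.
rewrite /Cstep; case: eqP => [-> _|] /=; first by case: h => [|[]].
by case: s => [|[|s]] //= _ _; rewrite andbT.
Qed.

Lemma EE_LL_path t : EE (LL_path t).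
Proof. by rewrite /EE /= catpath_tile_word catpath_Cstep // add1n. Qed.

(** Tiles are appended on the right: [s] lists the completed pairs of runs (l_i, k_i), and [m] is
    the final run of U, which may be empty. *)
Lemma run_decomposition t :
  exists (s : seq (nat * nat)) (m : nat),
    all (fun p => (0 < p.1)%N && (0 < p.2)%N) s /\
    true :: t = flatten [seq nseq p.1 true ++ nseq p.2 false | p <- s] ++ nseq m true.
Proof.
elim/last_ind: t => [|t b [s [m [s_gt0 def_t]]]]; first by exists [::], 1%N.
rewrite -rcons_cons def_t -cats1 -catA; case: b.
  by exists s, m.+1; rewrite -(nseqD m 1) addn1.
(* A tile DU after a nonempty final run closes a new pair; otherwise it lengthens the last run of
   DU, which exists because the word starts with U. *)
case: m def_t => [|m] def_t; last first.
  exists (rcons s (m.+1, 1%N)), 0%N; rewrite all_rcons s_gt0; split=> //.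
  by rewrite map_rcons flatten_rcons cats0.
case/lastP: s s_gt0 def_t => [//|s [l k]]; rewrite all_rcons /=.
move=> /andP[/andP[l_gt0 _] s_gt0] _.
exists (rcons s (l, k.+1)), 0%N; rewrite all_rcons s_gt0 /= l_gt0; split=> //.
rewrite !map_rcons !flatten_rcons /= cats0 -!catA; congr (_ ++ (_ ++ _)).
by rewrite -(nseqD k 1) addn1.
Qed.

Lemma LL_path_in t : LL (LL_path t).
Proof.
have [s [m [s_gt0 def_t]]] := run_decomposition t.
have def_P : LL_path t = tile_word (true :: t) ++ [:: Cstep (count id (true :: t))].
  by [].
have [/size0nil s0|size_s_gt0] := posnP (size s).
  apply: Or32; exists m; first by case: m def_t; rewrite s0.
  by rewrite def_P def_t s0 /= tile_word_nseq_true count_nseq mul1n cats1.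
apply: Or33; split; first exact: EE_LL_path.
(* Exponents are indexed from 1, hence [i.-1]. The default [(m, 0)] makes the exponent at index
   [r.+1] equal to [m], the final run. *)
exists (size s), (fun i => (nth (m, 0%N) s i.-1).1),
  (fun i => (nth (m, 0%N) s i.-1).2), (count id t).+1; split=> // [i|].
  by case: i => // i lt_i; apply/andP; move/(all_nthP (m, 0%N)): s_gt0; apply.
rewrite def_P def_t tile_word_cat tile_word_nseq_true -catA /= nth_default // -def_t.
congr (_ ++ _); rewrite big_add1 /=.
pose F (p : nat * nat) := nseq p.1 Up ++ flatten (nseq p.2 [:: Down; Up]).
rewrite -(big_nth (m, 0%N) xpredT F).
elim: s {s_gt0 def_t size_s_gt0} => [|p s IHs]; first by rewrite big_nil.
by rewrite big_cons -IHs /= !tile_word_cat tile_word_nseq_true tile_word_nseq_false.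
Qed.

Lemma LL_pathP P : LL P <-> P = [::] \/ exists t, P = LL_path t.
Proof.
split=> [|[->|[t ->]]]; [|exact: Or31|exact: LL_path_in].
case=> [->|[[//|l] _ ->]|[EP [r [l [k [s [r_gt0 lk_gt0 s_gt0 def_P]]]]]]].
- by left.
- right; exists (nseq l true).
  by rewrite /LL_path tile_word_nseq_true count_nseq mul1n cats1.
(* Ending on the x-axis forces the value of [s], so it suffices to write the rest of the path as U
   followed by tiles. *)
right; suff [t def_t] : exists t, P = Up :: tile_word t ++ [:: Cstep s].
  exists t; rewrite def_t /LL_path; move: EP.
  by rewrite /EE /= def_t /= catpath_tile_word catpath_Cstep // add1n => /eqP->.
pose w i := nseq (l i) true ++ nseq (k i) false.
have big_w m n : \big[cat/[::]]_(m <= i < n)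
    (nseq (l i) Up ++ flatten (nseq (k i) [:: Down; Up]))
    = tile_word (\big[cat/[::]]_(m <= i < n) w i).
  apply: (big_ind2 (fun P t => P = tile_word t)) => // [x1 t1 x2 t2 -> ->|i _].
    by rewrite tile_word_cat.
  by rewrite tile_word_cat tile_word_nseq_true tile_word_nseq_false.
have [l1_gt0 _] := lk_gt0 1%N r_gt0.
(* The first U of the first run is the initial step of [LL_path], hence the predecessor. *)
exists (nseq (l 1%N).-1 true ++ nseq (k 1%N) false ++
  \big[cat/[::]]_(2 <= i < r.+1) w i ++ nseq (l r.+1) true).
rewrite def_P big_ltn // big_w !tile_word_cat !tile_word_nseq_true.
by rewrite tile_word_nseq_false -!catA; case: (l 1%N) l1_gt0.
Qed.

(** The first letter of a tile determines the tile, so a tile word can be decoded from the left. *)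
Lemma LL_path_inj : injective LL_path.
Proof.
move=> t1 t2 [] /eqP; rewrite !cats1 eqseq_rcons => /andP[/eqP + _].
by elim: t1 t2 => [|[] t1 IHt] [|[] t2] //= [] /IHt->.
Qed.

(** * Counting the paths by tilings *)

Lemma mem_tilings n t : (t \in tilings n) = (size (tile_word t) == n).
Proof.
have cons_mem b c u s : ((b :: u) \in map (cons c) s) = (b == c) && (u \in s).
  apply/mapP/andP => [[v v_s [-> ->]]|[/eqP-> u_s]]; [by rewrite eqxx|by exists u].
(* The recursion goes back two steps, so the induction carries two consecutive lengths. *)
suff [] : (forall t, (t \in tilings n) = (size (tile_word t) == n)) /\
  (forall t, (t \in tilings n.+1) = (size (tile_word t) == n.+1)) by [].
elim: n {t} => [|n [IH0 IH1]].
  by split=> -[|[] [|[] t]].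
split=> // -[|b t].
  by rewrite mem_cat; apply/negbTE/norP; split; apply/mapP => -[].
by rewrite [tilings _]/= -/(tilings n.+1) mem_cat !cons_mem IH0 IH1; case: b => /=;
  rewrite ?orbF ?eqSS.
Qed.

Lemma tilings_uniq n : uniq (tilings n).
Proof.
suff /andP[] : uniq (tilings n) && uniq (tilings n.+1) by [].
elim: n => // n /andP[un0 un1]; rewrite un1 /= -/(tilings n.+1) cat_uniq.
rewrite !map_inj_uniq ?un0 ?un1 ?andbT //=; try by move=> ? ? [].
by apply/hasPn => _ /mapP[t _ ->]; apply/mapP => -[].
Qed.

Lemma size_tilings n :
  size (tilings n.+2) = (size (tilings n.+1) + size (tilings n))%N.
Proof. by rewrite /= size_cat !size_map. Qed.

Lemma ogf_uniq (A : set (seq step)) n (s : seq (seq step)) :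
  uniq s -> (forall P, of_length A n P <-> P \in s) -> ogf A n = (size s)%:Z.
Proof.
move=> s_uniq A_s; rewrite /ogf.
have -> : of_length A n = [set` [fset P in s]%fset]%classic.
  by apply/seteqP; split=> P /=; rewrite inE => /A_s.
by rewrite set_fsetK card_fseq undup_id.
Qed.

Lemma size_LL_path t : size (LL_path t) = (size (tile_word t)).+2.
Proof. by rewrite /= size_cat addn1. Qed.

Lemma ogf_LL0 : ogf LL 0 = 1.
Proof.
rewrite (@ogf_uniq _ _ [:: [::]]) // => P; rewrite inE.
split=> [[_ /size0nil->]|/eqP->] //.
by split=> //; exact: Or31.
Qed.

Lemma ogf_LL1 : ogf LL 1 = 0.
Proof.
rewrite (@ogf_uniq _ _ [::]) // => P; split=> // -[/LL_pathP[->//|[t ->]]].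
by rewrite /mkset size_LL_path.
Qed.

Lemma ogf_LL n : ogf LL n.+2 = (size (tilings n))%:Z.
Proof.
rewrite (@ogf_uniq _ _ (map LL_path (tilings n))) ?size_map //.
  by rewrite (map_inj_uniq LL_path_inj) tilings_uniq.
move=> P; split=> [[/LL_pathP[->//|[t ->]]]|/mapP[t + ->]].
  by rewrite /mkset size_LL_path => -[t_n]; rewrite map_f // mem_tilings t_n.
rewrite mem_tilings => /eqP t_n; split; first exact: LL_path_in.
by rewrite /mkset size_LL_path t_n.
Qed.

(** * Coefficients of the rational series *)

Lemma fps_mul_poly3 (R : nzRingType) (p : {poly R}) (g : fps R) n :
  (size p <= 3)%N ->
  fps_mul (fps_of_poly p) g n.+2 = p`_0 * g n.+2 + p`_1 * g n.+1 + p`_2 * g n.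
Proof.
move=> sz_p; rewrite /fps_mul /fps_of_poly !big_ord_recl big1 ?addr0 => [|i _].
  by rewrite /= /bump /= !add1n !subSS !subn0 addrA.
by rewrite nth_default ?mul0r // (leq_trans sz_p).
Qed.

Lemma fps_mul_coef0 (R : nzRingType) (f g : fps R) : fps_mul f g 0 = f 0%N * g 0%N.
Proof. by rewrite /fps_mul big_ord_recl big_ord0 addr0. Qed.

Lemma fps_mul_coef1 (R : nzRingType) (f g : fps R) :
  fps_mul f g 1 = f 0%N * g 1%N + f 1%N * g 0%N.
Proof. by rewrite /fps_mul !big_ord_recl big_ord0 addr0. Qed.

(** Comparing coefficients in [q * h = 1] gives h_0 = h_1 = 1 and h_(m+2) = h_(m+1) + h_m, the
    recursion of the tilings. *)
Lemma fps_inv_fibonacci n :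
  fps_inv (fps_of_poly (1 - 'X - 'X^2 : {poly int})) n = (size (tilings n))%:Z.
Proof.
set q := 1 - 'X - 'X^2; set h := fps_inv _.
have q0 : q`_0 = 1 by rewrite !coefE.
have q1 : q`_1 = -1 by rewrite !coefE.
have q2 : q`_2 = -1 by rewrite !coefE.
have sz_q : (size q <= 3)%N.
  by apply/leq_sizeP => -[|[|[|j]]] // _; rewrite !coefE.
have qh m : fps_mul (fps_of_poly q) h m = (1 : {poly int})`_m.
  by rewrite fps_mulV // /fps_of_poly q0 unitr1.
have h0 : h 0%N = 1.
  by have := qh 0%N; rewrite fps_mul_coef0 /fps_of_poly q0 mul1r coef1.
have h1 : h 1%N = 1.
  have := qh 1%N; rewrite fps_mul_coef1 /fps_of_poly q0 q1 h0 coef1 mul1r mulr1.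
  by move/eqP; rewrite subr_eq0 => /eqP.
have hS m : h m.+2 = h m.+1 + h m.
  have := qh m.+2; rewrite fps_mul_poly3 // q0 q1 q2 coef1 mul1r !mulN1r.
  by move/eqP; rewrite -addrA -opprD subr_eq0 => /eqP.
suff [] : h n = (size (tilings n))%:Z /\ h n.+1 = (size (tilings n.+1))%:Z by [].
by elim: n => [//|n [IH0 IH1]]; split=> //; rewrite hS size_tilings PoszD IH0 IH1.
Qed.

Lemma ogf_LL_eq :
  ogf LL = fps_div (fps_of_poly (1 - 'X)) (fps_of_poly (1 - 'X - 'X^2)).
Proof.
have p0 : (1 - 'X : {poly int})`_0 = 1 by rewrite !coefE.
have p1 : (1 - 'X : {poly int})`_1 = -1 by rewrite !coefE.
have p2 : (1 - 'X : {poly int})`_2 = 0 by rewrite !coefE.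
apply/funext => -[|[|n]]; rewrite /fps_div.
- by rewrite ogf_LL0 fps_mul_coef0 fps_inv_fibonacci /fps_of_poly p0.
- by rewrite ogf_LL1 fps_mul_coef1 !fps_inv_fibonacci /fps_of_poly p0 p1.
(* The factor 1 - x turns the Fibonacci numbers into the differences F_(n+2) - F_(n+1) = F_n, where
   F_n counts the tilings of length n. *)
rewrite ogf_LL fps_mul_poly3; last first.
  by apply/leq_sizeP => -[|[|[|j]]] // _; rewrite !coefE.
rewrite !fps_inv_fibonacci p0 p1 p2 mul1r mulN1r mul0r addr0 size_tilings PoszD.
by rewrite addrAC subrr add0r.
Qed.

Theorem theorem3p12 :
  ogf LL = fps_div (fps_of_poly (1 - 'X)) (fps_of_poly (1 - 'X - 'X^2)) /\
  fps_eqO 12 (ogf LL)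
    (fps_of_poly (1 + 'X^2 + 'X^3 + 2 * 'X^4 + 3 * 'X^5 + 5 * 'X^6 + 8 * 'X^7
                  + 13 * 'X^8 + 21 * 'X^9 + 34 * 'X^10 + 55 * 'X^11)).
Proof.
split; first exact: ogf_LL_eq.
have coef_natM (c m i : nat) : (c%:R * 'X^m : {poly int})`_i = (c * (i == m))%:R.
  by rewrite mulr_natl coefMn coefXn -mulrnA mulnC.
move=> [|[|n]] lt_n; rewrite /fps_of_poly !coefD !coef_natM coef1 !coefXn.
- by rewrite ogf_LL0.
- by rewrite ogf_LL1.
(* Only ten values of [n] remain below the bound, and for each both sides are computed. *)
by rewrite ogf_LL; do 10 ![case: n lt_n => [//|n] lt_n].
Qed.
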